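(* Consider two fractional order systems $$S_1:\ D_t^{\gamma_1}x_1(t)=f_1(x_1,u_1,t),\quad y_1=h_1(x_1,u_1,t),$$ $$S_2:\ D_t^{\gamma_2}x_2(t)=f_2(x_2,u_2,t),\quad y_2=h_2(x_2,u_2,t).$$ If both systems are passive with the same order $\beta$, then the parallel interconnection and the feedback interconnection of $S_1$ and $S_2$ are also passive with order $\beta$.
   Context: For each $i$: $\gamma_i\in(0,1)$, $f_i$ is piecewise continuous in $t$ and locally Lipschitz on a set containing the origin, and $f_i(0,0,t)=0$; all inputs and outputs have the same dimension. For $\alpha\in(0,1)$, $D_t^{\alpha}$ is the Caputo derivative $D_t^{\alpha}g(t)=\frac{1}{\Gamma(1-\alpha)}\int_0^t (t-\tau)^{-\alpha}g'(\tau)\,d\tau$ (componentwise). A system with state $x$, input $u$, output $y$ is passive with order $\beta\in(0,1)$ if there is a positive semi-definite storage function $V(x,t)$ (i.e. $V\ge0$, $V(0,t)=0$) such that $u^{T}y\ge D_t^{\beta}V(x,t)$ for all $t\ge 0$ along all trajectories, where $D_t^{\beta}V(x,t)$ is the Caputo derivative of $t\mapsto V(x(t),t)$. Parallel interconnection: the system with state $x=(x_1^T,x_2^T)^T$, input $u=u_1=u_2$ and output $y=y_1+y_2$. Feedback interconnection: the system with state $x=(x_1^T,x_2^T)^T$, external input $r$ and output $y=y_1$, where $u_1=r-y_2$ and $u_2=y_1$. *)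

(* Defs.v *)
From mathcomp Require Import all_boot all_order all_algebra.
From mathcomp Require Import all_classical all_reals all_analysis.
Import Order.TTheory GRing.Theory Num.Theory numFieldNormedType.Exports.

Set Implicit Arguments.
Unset Strict Implicit.
Unset Printing Implicit Defensive.

Local Open Scope classical_set_scope.
Local Open Scope ring_scope.

Definition Gamma (R : realType) (a : R) : R :=
  \int[lebesgue_measure]_(x in `]0, +oo[) (x `^ (a - 1) * expR (- x)).

(* [g] is absolutely continuous on [0, t], in Lebesgue's form: it has a
   derivative almost everywhere and is the indefinite integral of it.  The
   function [dg] is a Borel representative of g'; it is determined by [g] up to
   a null set. *)
Definition ac_derivative (R : realType) (t : R) (g dg : R -> R) : Prop :=
  [/\ {ae lebesgue_measure, forall s : R,
         s \in `]0, t[ -> is_derive s (1 : R) g (dg s)},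
      lebesgue_measure.-integrable `[0, t] (EFin \o dg) &
      forall s : R, s \in `[0, t] ->
        g s = g 0 + \int[lebesgue_measure]_(r in `[0, s]) dg r].

(* Relational, so that writing a Caputo derivative asserts that it exists. *)
Definition caputo_pos (R : realType) (alpha : R) (g : R -> R) (t d : R) : Prop :=
  exists dg : R -> R,
    [/\ ac_derivative t g dg,
        lebesgue_measure.-integrable `[0, t]
          (EFin \o (fun r => (t - r) `^ (- alpha) * dg r)) &
        d = (Gamma (1 - alpha))^-1 *
            \int[lebesgue_measure]_(r in `[0, t])
              ((t - r) `^ (- alpha) * dg r)].

(* At the initial time the Caputo derivative is taken to be its right limit.
   Reading the formula as an integral over the degenerate interval [0, 0] would
   give 0 for every [g], and the equation D^gamma x = f(x, u, t) would then
   exclude every initial state with f(x(0), u(0), 0) <> 0. *)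
Definition caputo (R : realType) (alpha : R) (g : R -> R) (t d : R) : Prop :=
  if 0 < t then caputo_pos alpha g t d
  else exists2 c : R -> R,
         \forall s \near (0 : R)^'+, caputo_pos alpha g s (c s) &
         c s @[s --> (0 : R)^'+] --> d.

Record fsystem (R : realType) (n m : nat) := FSystem {
  forder : R;
  fdyn : 'cV[R]_n -> 'cV[R]_m -> R -> 'cV[R]_n;
  fout : 'cV[R]_n -> 'cV[R]_m -> R -> 'cV[R]_m }.

(* On every [0, T], finitely many discontinuities, all with finite one-sided
   limits.  The point 0 may always be put in [s], so values of [g] at negative
   times are irrelevant. *)
Definition piecewise_continuous (R : realType) (n : nat) (g : R -> 'cV[R]_n) :
  Prop :=
  forall T : R, 0 < T ->
    (exists s : seq R, forall t : R,
       0 <= t <= T -> t \notin s -> {for t, continuous g}) /\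
    (forall t : R, 0 <= t <= T ->
       cvg (g r @[r --> t^'+]) /\ (0 < t -> cvg (g r @[r --> t^'-]))).

(* Each point of [D] has a full neighbourhood on which f(., ., t) is Lipschitz,
   with a constant uniform over t in compact intervals. *)
Definition locally_lipschitz_on (R : realType) (n m : nat)
    (f : 'cV[R]_n -> 'cV[R]_m -> R -> 'cV[R]_n)
    (D : set ('cV[R]_n * 'cV[R]_m)) : Prop :=
  forall z, D z -> forall T : R, 0 < T ->
    exists k : R, exists2 U : set ('cV[R]_n * 'cV[R]_m), nbhs z U &
      forall t : R, 0 <= t <= T -> k.-lipschitz_U (fun w => f w.1 w.2 t).

Definition fsystem_regular (R : realType) (n m : nat) (S : fsystem R n m) :
  Prop :=
  [/\ 0 < forder S < 1,
      forall x u, piecewise_continuous (fdyn S x u),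
      exists2 D : set ('cV[R]_n * 'cV[R]_m), D (0, 0) &
        locally_lipschitz_on (fdyn S) D &
      forall t : R, 0 <= t -> fdyn S 0 0 t = 0].

(* A system in general is the set of its trajectories (state, input, output) on
   [0, +oo[.  An interconnection has no single order, and its algebraic loop
   need not be solvable, so it is in general not an [fsystem]. *)
Definition behavior (R : realType) (n m : nat) : Type :=
  (R -> 'cV[R]_n) -> (R -> 'cV[R]_m) -> (R -> 'cV[R]_m) -> Prop.

Definition trajectory (R : realType) (n m : nat) (S : fsystem R n m) :
  behavior R n m :=
  fun x u y => forall t : R, 0 <= t ->
    (forall i : 'I_n,
       caputo (forder S) (fun s => x s i 0) t (fdyn S (x t) (u t) t i 0)) /\
    y t = fout S (x t) (u t) t.

Definition passive (R : realType) (n m : nat) (beta : R)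
    (B : behavior R n m) : Prop :=
  exists V : 'cV[R]_n -> R -> R,
    [/\ forall x (t : R), 0 <= t -> 0 <= V x t,
        forall t : R, 0 <= t -> V 0 t = 0 &
        forall x u y, B x u y -> forall t : R, 0 <= t ->
          exists2 d : R, caputo beta (fun s => V (x s) s) t d &
            d <= ((u t)^T *m y t) 0 0].

Definition parallel (R : realType) (n1 n2 m : nat)
    (B1 : behavior R n1 m) (B2 : behavior R n2 m) : behavior R (n1 + n2) m :=
  fun x u y => exists x1 x2 u1 u2 y1 y2,
    [/\ B1 x1 u1 y1, B2 x2 u2 y2 &
        forall t : R, 0 <= t ->
          [/\ x t = col_mx (x1 t) (x2 t), u1 t = u t, u2 t = u t &
              y t = y1 t + y2 t]].

Definition feedback (R : realType) (n1 n2 m : nat)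
    (B1 : behavior R n1 m) (B2 : behavior R n2 m) : behavior R (n1 + n2) m :=
  fun x r y => exists x1 x2 u1 u2 y1 y2,
    [/\ B1 x1 u1 y1, B2 x2 u2 y2 &
        forall t : R, 0 <= t ->
          [/\ x t = col_mx (x1 t) (x2 t), u1 t = r t - y2 t, u2 t = y1 t &
              y t = y1 t]].

(* Main.v *)
(* The sum of the two storage functions is a storage function: the Caputo
   derivative is additive, and in both interconnections the supply rate u^T y
   equals u1^T y1 + u2^T y2 (for feedback, (r - y2)^T y1 + y1^T y2 = r^T y1). *)

Require Import Defs.
From mathcomp Require Import all_boot all_order all_algebra.
From mathcomp Require Import all_classical all_reals all_analysis.
Import Order.TTheory GRing.Theory Num.Theory numFieldNormedType.Exports.
Local Open Scope ring_scope.

Section CaputoAdditivity.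
Variables (R : realType) (g g1 g2 : R -> R).
(* Interconnections constrain the composite state at nonnegative times only. *)
Hypothesis gE : forall s : R, 0 <= s -> g s = g1 s + g2 s.

Lemma ac_derivativeD (t : R) (dg1 dg2 : R -> R) :
  ac_derivative t g1 dg1 -> ac_derivative t g2 dg2 ->
  ac_derivative t g (fun r => dg1 r + dg2 r).
Proof.
move=> [D1 I1 E1] [D2 I2 E2]; split.
- apply: filterS2 D1 D2; first exact: (ae_filter_ringOfSetsType lebesgue_measure).
  move=> s H1 H2 st; have {}H1 := H1 st; have {}H2 := H2 st.
  (* Since [gE] holds only for nonnegative times, differentiability is transferred locally: [s] is
     interior to []0, t[], hence has a neighbourhood of positive reals on which [g] agrees with
     [g1 + g2]. *)
  apply: (near_eq_is_derive (f := g1 + g2)).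
  have s0 : 0 < s by move: st; rewrite in_itv /= => /andP[].
  by near=> r; apply/esym/gE/ltW; near: r; exact: lt_nbhsr.
- have -> : (EFin \o (fun r => dg1 r + dg2 r)) =
    ((EFin \o dg1) \+ (EFin \o dg2))%E by [].
  exact: integrableD.
- move=> s st.
  have /andP[s0 le_st] : 0 <= s <= t by move: st; rewrite in_itv.
  have sub : (`[0, s]%classic `<=` `[0, t])%classic.
    by apply: subset_itvl; rewrite bnd_simp.
  rewrite gE // gE // E1 // E2 // RintegralD //; first by rewrite addrACA.
  + exact: integrableS I1.
  + exact: integrableS I2.
Unshelve. all: by end_near. Qed.

(** Each kernel-weighted derivative is integrable on its own by the definition of [caputo_pos], and
    this is what allows the integral of the sum to split. *)
Lemma caputo_posD (alpha t d1 d2 : R) :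
  caputo_pos alpha g1 t d1 -> caputo_pos alpha g2 t d2 ->
  caputo_pos alpha g t (d1 + d2).
Proof.
move=> [dg1 [A1 I1 ->]] [dg2 [A2 I2 ->]].
exists (fun r => dg1 r + dg2 r).
have mulE : (fun r => (t - r) `^ (- alpha) * (dg1 r + dg2 r)) =
    (fun r => (t - r) `^ (- alpha) * dg1 r + (t - r) `^ (- alpha) * dg2 r).
  by apply/funext => r; rewrite mulrDr.
rewrite mulE; split.
- exact: ac_derivativeD.
- exact: (integrableD _ I1 I2).
- by rewrite RintegralD // mulrDr.
Qed.

Lemma caputoD (alpha t d1 d2 : R) :
  caputo alpha g1 t d1 -> caputo alpha g2 t d2 -> caputo alpha g t (d1 + d2).
Proof.
rewrite /caputo; case: ifP => _; first exact: caputo_posD.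
(* Initial time: the right limits add, and both derivatives exist at all small positive times common
   to the two neighbourhoods. *)
move=> [c1 N1 C1] [c2 N2 C2]; exists (fun s => c1 s + c2 s); last exact: cvgD.
by apply: filterS2 N1 N2 => s; apply: caputo_posD.
Qed.

End CaputoAdditivity.

(** Isolates what the parallel and feedback cases share: a stacked state and a supply rate that
    splits over the two subsystems. *)
Lemma passive_interconnection (R : realType) (n1 n2 m : nat) (beta : R)
    (B1 : behavior R n1 m) (B2 : behavior R n2 m)
    (B : behavior R (n1 + n2) m) :
  passive beta B1 -> passive beta B2 ->
  (forall x u y, B x u y -> exists x1 x2 u1 u2 y1 y2,
    [/\ B1 x1 u1 y1, B2 x2 u2 y2 &
        forall t : R, 0 <= t -> x t = col_mx (x1 t) (x2 t) /\
          (u t)^T *m y t = (u1 t)^T *m y1 t + (u2 t)^T *m y2 t]) ->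
  passive beta B.
Proof.
move=> [V1 [V1ge0 V10 P1]] [V2 [V2ge0 V20 P2]] HB.
exists (fun x t => V1 (usubmx x) t + V2 (dsubmx x) t); split.
- by move=> x t t0; rewrite addr_ge0 ?V1ge0 ?V2ge0.
- by move=> t t0; rewrite !linear0 V10 // V20 // addr0.
move=> x u y /HB[x1 [x2 [u1 [u2 [y1 [y2 [H1 H2 E]]]]]]] t t0.
have [d1 C1 le1] := P1 _ _ _ H1 t t0.
have [d2 C2 le2] := P2 _ _ _ H2 t t0.
exists (d1 + d2); last by have [_ ->] := E t t0; rewrite mxE lerD.
apply: caputoD C1 C2 => s s0.
by have [-> _] := E s s0; rewrite col_mxKu col_mxKd.
Qed.

Theorem theorem3p9 (R : realType) (n1 n2 m : nat)
    (S1 : fsystem R n1 m) (S2 : fsystem R n2 m)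
    (hS1 : fsystem_regular S1) (hS2 : fsystem_regular S2)
    (beta : R) (hbeta : 0 < beta < 1)
    (hP1 : passive beta (trajectory S1)) (hP2 : passive beta (trajectory S2)) :
  passive beta (parallel (trajectory S1) (trajectory S2)) /\
  passive beta (feedback (trajectory S1) (trajectory S2)).
Proof.
split; apply: (passive_interconnection _ _ _ _ _ _ _ _ hP1 hP2) => x u y;
    move=> [x1 [x2 [u1 [u2 [y1 [y2 [H1 H2 E]]]]]]];
    exists x1, x2, u1, u2, y1, y2; split=> // t t0.
- by have [-> -> -> ->] := E t t0; split=> //; rewrite mulmxDr.
have [-> -> -> ->] := E t t0; split=> //.
(* A 1 by 1 matrix is its own transpose; hence the coupling terms of the loop cancel. *)
have sym : (y1 t)^T *m y2 t = (y2 t)^T *m y1 t.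
  by rewrite -[RHS]trmxK trmx_mul trmxK [RHS]mx11_scalar mxE -mx11_scalar.
by rewrite raddfB /= mulmxBl sym subrK.
Qed.
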